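(* For a real parameter $x>2$, let $\mathcal A_x$ be the following preemptive online algorithm for $\textsc{Part}$ with $p=2$: it chooses $\delta\in(0,1)$ uniformly at random and sets $i\gets 0$; for each request $j=1,2,\dots$, if $j=\lceil x^{i+\delta}\rceil$ it moves its single separator to the current position (i.e. right after request $j$) and sets $i\gets i+1$. Let $R^n_{\mathcal A_x}$ denote the ratio between the bottleneck value of the partitioning produced by $\mathcal A_x$ on the all-ones sequence of length $n$ and the optimal bottleneck value $\lceil n/2\rceil$. Then there is a constant $x\approx 3.052$ such that $\mathbb E[R^n_{\mathcal A_x}] = c + O(n^{-1})$ for a constant $c\approx 1.344$.
   Context: $\textsc{Part}$ with $p=2$: a sequence of positive integers arrives online and one separator must be placed so as to split it into two contiguous blocks minimizing the larger block weight (the bottleneck value). In the preemptive online model, upon processing the current request the algorithm may remove its previously placed separator and may place a separator only right after the current request; when the sequence ends, the separator in place defines the partition. The expectation is over the random choice of $\delta$. *)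

(* Defs.v *)
From mathcomp Require Import all_boot all_order all_algebra.
From mathcomp Require Import all_classical all_reals all_analysis.
From mathcomp Require Import zify.

Set Implicit Arguments.
Unset Strict Implicit.
Unset Printing Implicit Defensive.

Import Order.TTheory GRing.Theory Num.Theory.
Import numFieldNormedType.Exports.

Local Open Scope ring_scope.

(* A separator [Some k] splits the request sequence right after request [k]
   (requests are numbered from 1); [None] means that no separator is placed,
   so that the whole sequence is one block. *)
Definition bottleneck (sep : option nat) (r : seq nat) : nat :=
  match sep with
  | Some k => maxn (sumn (take k r)) (sumn (drop k r))
  | None => sumn r
  end.

Definition opt_bottleneck (r : seq nat) : nat :=
  \big[minn/bottleneck None r]_(k < (size r).+1) bottleneck (Some (k : nat)) r.

(* [Place] puts the unique separator right after the current request, thereby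
   discarding its previous position. *)
Inductive sep_action := Keep | Remove | Place.

(* The step function sees only the current request (and the internal state),
   not the future requests nor the length of the sequence. *)
Record preemptive_alg := PreemptiveAlg {
  alg_state : Type;
  alg_init : alg_state;
  alg_step : alg_state -> nat -> alg_state * sep_action
}.

Definition act (a : sep_action) (j : nat) (sep : option nat) : option nat :=
  match a with
  | Keep => sep
  | Remove => None
  | Place => Some j
  end.

(* [j] is the index of the first request of [r]. *)
Fixpoint run (A : preemptive_alg) (st : alg_state A) (sep : option nat)
    (j : nat) (r : seq nat) : option nat :=
  match r with
  | [::] => sep
  | w :: r' =>
      let: (st', a) := alg_step st w in run st' (act a j sep) j.+1 r'
  end.

Definition final_separator (A : preemptive_alg) (r : seq nat) : option nat :=
  run (alg_init A) None 1 r.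

Definition ratio (R : realType) (A : preemptive_alg) (r : seq nat) : R :=
  (bottleneck (final_separator A r) r)%:R / (opt_bottleneck r)%:R.

(* The algorithm A_x for a fixed outcome [delta] of its random choice; the
   state is the pair (number of requests seen so far, value of i). *)
Definition geom_step (R : realType) (x delta : R) (st : nat * nat) (_ : nat) :
    (nat * nat) * sep_action :=
  let: (j', i) := st in
  let j := j'.+1 in
  if j%:Z == Num.ceil (x `^ (i%:R + delta)) then ((j, i.+1), Place)
  else ((j, i), Keep).

Definition geom_alg (R : realType) (x delta : R) : preemptive_alg :=
  PreemptiveAlg (0%N, 0%N) (geom_step x delta).

(* Expected ratio of A_x on n ones. [uniform_prob] lives on the closed
   interval [0, 1], which differs from (0, 1) by a null set. The ratio takes
   values in [0, 2], so that [fine] discards no infinite value. *)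
Definition expected_ratio (R : realType) (x : R) (n : nat) : R :=
  fine ('E_(uniform_prob (@ltr01 R))[fun delta =>
          ratio R (geom_alg x delta) (nseq n 1%N)])%E.

Lemma opt_bottleneck_ones (n : nat) : opt_bottleneck (nseq n 1%N) = uphalf n.
Proof.
have bE k : (k <= n)%N ->
    bottleneck (Some k) (nseq n 1%N) = maxn k (n - k).
  by move=> kn; rewrite /= take_nseq// drop_nseq !sumn_nseq !mul1n.
have uE : (n - uphalf n)%N = n./2 by have := odd_double_half n; rewrite uphalf_half; lia.
have hu : (n./2 <= uphalf n)%N by rewrite uphalf_half leq_addl.
have un : (uphalf n <= n)%N by rewrite leq_uphalf_double -addnn leq_addr.
apply/eqP; rewrite eqn_leq; apply/andP; split.
- have lt : (uphalf n < (size (nseq n 1%N)).+1)%N by rewrite size_nseq ltnS.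
  suff: (opt_bottleneck (nseq n 1) <= bottleneck (Some (uphalf n)) (nseq n 1))%N.
    by rewrite bE// uE (maxn_idPl hu).
  rewrite /opt_bottleneck; have := mem_index_enum (Ordinal lt).
  elim: (index_enum _) => // i s IHs; rewrite inE big_cons => /orP[/eqP <-|ins].
    exact: geq_minl.
  exact: leq_trans (geq_minr _ _) (IHs ins).
- rewrite /opt_bottleneck; elim/big_ind: _ => [|a b ha hb|k _].
  + by rewrite /= sumn_nseq mul1n.
  + by rewrite leq_min ha hb.
  + have kn : (k <= n)%N by have := ltn_ord k; rewrite [X in (_ < X.+1)%N]size_nseq ltnS.
    rewrite bE// leq_uphalf_double; lia.
Qed.

(* Main.v *)
Require Import Defs.
From mathcomp Require Import all_boot all_order all_algebra.
From mathcomp Require Import all_classical all_reals all_analysis.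
From mathcomp Require Import measurable_realfun zify ring lra.

Set Implicit Arguments.
Unset Strict Implicit.
Unset Printing Implicit Defensive.

Import Order.TTheory GRing.Theory Num.Theory.
Import numFieldNormedType.Exports.

Local Open Scope ring_scope.
Local Open Scope classical_set_scope.

(* Write n = x^(m + theta) with 0 <= theta < 1. The last power x^(i + delta) that is at
   most n equals n x^(-u), where u is theta - delta taken modulo 1 in [0, 1). Up to
   O(1/n) the ratio is therefore 2 max(x^(-u), 1 - x^(-u)). Since delta is uniform,
   so is u, and the expectation converges to the integral of this function over
   [0, 1], which is 2 + 2 (1/x - ln 2) / ln x whatever n is. This is below 1.345
   already at x = 3.052. *)

Definition geom_place (R : realType) (x delta : R) (i : nat) : nat :=
  `|Num.ceil (x `^ (i%:R + delta))|%N.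

(** * Position of the final separator and the ratio for a fixed [delta] *)

Section geometric_separator.
Variables (R : realType) (x delta : R).

Local Notation place := (geom_place x delta).

Let placeE i : (place i)%:Z = Num.ceil (x `^ (i%:R + delta)).
Proof. by rewrite /geom_place gez0_abs// ceil_ge0 (lt_le_trans _ (powR_ge0 _ _)). Qed.

Let place_le i (n : nat) : (place i <= n)%N = (x `^ (i%:R + delta) <= n%:R).
Proof. by rewrite -lez_nat placeE ceil_le_int. Qed.

Let place_gt i (n : nat) : (n < place i)%N = (n%:R < x `^ (i%:R + delta)).
Proof. by rewrite ltnNge place_le -ltNge. Qed.

(* Consecutive powers differ by more than 1, so their ceilings are distinct and
   no placement is skipped. *)
Let place_lt : 2 < x -> 0 <= delta -> forall i, (place i < place i.+1)%N.
Proof.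
move=> x2 d0 i.
rewrite place_gt; have /andP[+ _] := ceil_itv (x `^ (i%:R + delta)).
rewrite -placeE intrB /=.
have -> : i.+1%:R + delta = 1 + (i%:R + delta) by rewrite -natr1; ring.
rewrite [x `^ (1 + _)]powRD; last by apply/implyP => _; lra.
rewrite powRr1; last by lra.
have : 1 <= x `^ (i%:R + delta).
  by rewrite -[leLHS](powRr0 x) ler_powR ?addr_ge0 ?ler0n//; lra.
move: (x `^ _) => y y1; rewrite ltrBlDr => h.
apply: (lt_le_trans h); nra.
Qed.

Let run_keep i m j sep (w : nat) : (j + m < place i)%N ->
  run (A := geom_alg x delta) (j, i) sep j.+1 (nseq m w) = sep.
Proof.
elim: m j => //= m IH j jm; rewrite -placeE eqz_nat ifN ?IH//; first by lia.
by rewrite neq_ltn; apply/orP; left; lia.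
Qed.

(** Induction on the number [m] of remaining requests, with the invariant that the next target
    [place i] is still ahead. A hit at [i < k] moves on to [place i.+1], which is again ahead; after
    a hit at [i = k] the sequence ends before the next target. *)
Let run_place k m j i sep (w : nat) : 2 < x -> 0 <= delta ->
  (i <= k)%N -> (j < place i)%N ->
  (place k <= j + m)%N -> (j + m < place k.+1)%N ->
  run (A := geom_alg x delta) (j, i) sep j.+1 (nseq m w) = Some (place k).
Proof.
move=> x2 d0; have plt := place_lt x2 d0.
have pmono : {homo place : a b / (a <= b)%N}.
  by apply: homo_leq => // a; [exact: leq_trans | exact: ltnW].
elim: m j i sep => [|m IH] j i sep ik ji kj jk.
  (* With no request left, [place k <= j < place i <= place k] is absurd. *)
  by have := pmono _ _ ik; lia.
rewrite /= -placeE eqz_nat; case: eqP => ij; last by rewrite IH//; lia.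
move: ik; rewrite leq_eqVlt => /predU1P[ik|ik]; last first.
  by apply: IH => //; have := plt i; lia.
by move: jk; rewrite -ik -ij => jk; apply: run_keep; lia.
Qed.

Lemma final_separator_geom k n (w : nat) : 2 < x -> 0 <= delta ->
  x `^ (k%:R + delta) <= n%:R < x `^ (k.+1%:R + delta) ->
  final_separator (geom_alg x delta) (nseq n w) = Some (place k).
Proof.
move=> x2 d0 /andP[kn nk].
by apply: (@run_place k) => //; rewrite ?add0n ?place_le ?place_gt ?powR_gt0//; lra.
Qed.

(* Rounding the separator costs less than 1 in the bottleneck, and rounding the
   optimum [n / 2] up costs at most 2 / n in the ratio. *)
Lemma ratio_geom_near k n : 2 < x -> 0 <= delta ->
  x `^ (k%:R + delta) <= n%:R < x `^ (k.+1%:R + delta) ->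
  `|Defs.ratio R (geom_alg x delta) (nseq n 1%N) -
    2 * Num.max (x `^ (k%:R + delta) / n%:R) (1 - x `^ (k%:R + delta) / n%:R)|
    <= 4 / n%:R.
Proof.
move=> x2 d0 kn; set s := x `^ _ / _.
rewrite /Defs.ratio (final_separator_geom _ x2 d0 kn) opt_bottleneck_ones.
have /andP[kn1 _] := kn.
have n0 : 0 < n%:R :> R by apply: lt_le_trans kn1; apply: powR_gt0; lra.
have Kn : (place k <= n)%N by rewrite place_le.
rewrite /= take_nseq// drop_nseq !sumn_nseq !mul1n.
have sE : x `^ (k%:R + delta) = s * n%:R by rewrite divfK ?gt_eqF.
have sK : s * n%:R <= (place k)%:R by rewrite -sE -place_le.
have Ks : (place k)%:R < s * n%:R + 1.
  rewrite -sE -ltrBlDr; have /andP[+ _] := ceil_itv (x `^ (k%:R + delta)).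
  by rewrite -placeE intrB.
have hn1 : n%:R <= 2 * (uphalf n)%:R :> R.
  by rewrite -natrM ler_nat; have := leq_uphalf_double n (uphalf n); lia.
have hn2 : 2 * (uphalf n)%:R <= n%:R + 1 :> R.
  by rewrite -natrM natr1 ler_nat uphalf_half; have := odd_double_half n; lia.
set M := maxn _ _; set h := (uphalf n)%:R in hn1 hn2 *.
have Mn : M%:R <= n%:R :> R by rewrite ler_nat geq_max Kn leq_subr.
have Mm : `|M%:R - n%:R * Num.max s (1 - s)| <= 1.
  rewrite maxr_pMr ?(ltW n0)// mulrBr mulr1 [n%:R * s]mulrC.
  rewrite /M; case: (leqP (place k) (n - place k)) => [le1|lt1].
    rewrite natrB//; move: le1; rewrite -(ler_nat R) natrB// => le1.
    by rewrite ler_norml; case: (leP (s * n%:R)) => ?; apply/andP; split; lra.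
  move: lt1; rewrite -(ltr_nat R) natrB// => lt1.
  by rewrite ler_norml; case: (leP (s * n%:R)) => ?; apply/andP; split; lra.
have h0 : 0 < h by lra.
(* The two rounding errors are separated. The first term is at most [2 / n] because [M] is within 1
   of its unrounded value, the second because [M <= n], [2 h - n <= 1] and [n <= 2 h]. *)
have -> : M%:R / h - 2 * Num.max s (1 - s) =
  2 * (M%:R - n%:R * Num.max s (1 - s)) / n%:R
  - M%:R * (2 * h - n%:R) / (n%:R * h).
  by field; rewrite !gt_eqF.
apply: le_trans (ler_normB _ _) _.
have -> : 4 / n%:R = 2 / n%:R + 2 / n%:R :> R by field; rewrite gt_eqF.
apply: lerD.
  rewrite !normrM normfV [`|n%:R|]gtr0_norm// ler_pdivrMr// divfK ?gt_eqF//.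
  by rewrite ger0_norm//; lra.
rewrite ger0_norm; last by rewrite divr_ge0 ?mulr_ge0 ?ler0n//; lra.
rewrite ler_pdivrMr ?mulr_gt0// mulrA divfK ?gt_eqF//.
apply: le_trans (_ : n%:R * 1 <= _); last by lra.
by rewrite ler_pM ?ler0n//; lra.
Qed.

End geometric_separator.

(** * Measurability of the ratio as a function of [delta] *)

Lemma measurable_run_geom (R : realType) (x : R) (g : option nat -> R)
    (st : nat * nat) (sep : option nat) (j : nat) (r : seq nat) :
  measurable_fun setT
    (fun delta : R => g (run (A := geom_alg x delta) st sep j r)).
Proof.
elim: r st sep j => [|w r IH] [j' i] sep j /=; first exact: measurable_cst.
(* The ceiling equals [j'.+1] exactly when the power lies in []j', j'.+1]], which is a pair of
   measurable comparisons. *)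
rewrite [X in measurable_fun _ X](_ : _ = fun delta =>
    if (j'%:R < x `^ (i%:R + delta)) && (x `^ (i%:R + delta) <= j'.+1%:R)
    then g (run (A := geom_alg x delta) (j'.+1, i.+1) (Some j) j.+1 r)
    else g (run (A := geom_alg x delta) (j'.+1, i) sep j.+1 r)); last first.
  apply/funext => delta; rewrite eq_sym ceil_eq.
  rewrite (_ : j'.+1%:Z - 1 = j'%:Z); last by lia.
  by case: ifP.
have mp : measurable_fun setT (fun delta : R => x `^ (i%:R + delta)).
  by apply: measurableT_comp (measurable_powRr x) _; exact: measurable_funD.
apply: measurable_fun_ifT; [|exact: IH|exact: IH].
by apply: measurable_and; [exact: measurable_fun_ltr|exact: measurable_fun_ler].
Qed.

Lemma measurable_ratio_geom (R : realType) (x : R) (r : seq nat) :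
  measurable_fun setT (fun delta : R => Defs.ratio R (geom_alg x delta) r).
Proof.
exact: (@measurable_run_geom R x
  (fun s => (bottleneck s r)%:R / (opt_bottleneck r)%:R)).
Qed.

Lemma ratio_ge0 (R : realType) (A : preemptive_alg) r : 0 <= Defs.ratio R A r.
Proof. by rewrite divr_ge0 ?ler0n. Qed.

(** * Polynomial bounds for logarithms *)

Lemma is_derive_ge0_le (R : realType) (f df : R -> R) (a b : R) : a <= b ->
  (forall u, a <= u <= b -> is_derive u 1 f (df u)) ->
  (forall u, a <= u <= b -> 0 <= df u) -> f a <= f b.
Proof.
move=> ab fdf df0; have oc u : u \in `]a, b[%R -> a <= u <= b.
  by rewrite in_itv /= => /andP[au ub]; rewrite !ltW.
apply: (@ger0_derive1_ndecr _ f a b) => //.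
- by move=> u /oc /fdf[].
- by move=> u /oc uab; rewrite derive1E; have [_ ->] := fdf _ uab; exact: df0.
- by apply: derivable_within_continuous => u; rewrite in_itv /= => /fdf[].
Qed.

(** The function is twice the inverse hyperbolic tangent; its derivative is a geometric series in
    [u ^+ 2]. *)
Lemma is_derive_ln_ratio (R : realType) (u : R) : -1 < u < 1 ->
  is_derive u 1 ((@ln R \o (cst 1 + id)) - (@ln R \o (cst 1 - id)))
    (2 / (1 - u ^+ 2)).
Proof.
move=> u1.
have l1 : is_derive (1 + u) 1 (@ln R) (1 + u)^-1 by apply: is_derive1_ln; lra.
have l2 : is_derive (1 - u) 1 (@ln R) (1 - u)^-1 by apply: is_derive1_ln; lra.
have d1 : is_derive u 1 (cst 1 + id : R -> R) (0 + 1) by exact: is_deriveD.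
have d2 : is_derive u 1 (cst 1 - id : R -> R) (0 - 1) by exact: is_deriveB.
have e1 : is_derive u 1 (@ln R \o (cst 1 + id)) _ :=
  @is_derive1_comp R (@ln R) (cst 1 + id) u _ _ l1 d1.
have e2 : is_derive u 1 (@ln R \o (cst 1 - id)) _ :=
  @is_derive1_comp R (@ln R) (cst 1 - id) u _ _ l2 d2.
apply: is_derive_eq (is_deriveB e1 e2) _.
field; apply/and3P; split; nra.
Qed.

Lemma is_derive_monomial (R : realType) (c u : R) (n : nat) :
  is_derive u 1 (fun v => c * v ^+ n.+1) (c * (n.+1%:R * u ^+ n)).
Proof.
have h : is_derive u 1 (id ^+ n.+1 : R -> R) _ :=
  @is_deriveX R R id n.+1 u 1 1 (is_derive_id u 1).
rewrite (_ : (fun v => _) = c *: (id ^+ n.+1 : R -> R)); last first.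
  by apply/funext => v; rewrite !fctE.
apply: is_derive_eq (@is_deriveZ R R R (id ^+ n.+1) c u 1 _ h) _.
by rewrite /GRing.scale /= mulr1.
Qed.

(** The left side truncates the power series. The difference of the two sides vanishes at 0 and has
    derivative [2 u ^+ 8 / (1 - u ^+ 2)], which is nonnegative. *)
Lemma ln_ratio_ge (R : realType) (t : R) : 0 <= t < 1 ->
  2 * t + 2 / 3 * t ^+ 3 + 2 / 5 * t ^+ 5 + 2 / 7 * t ^+ 7
    <= ln ((1 + t) / (1 - t)).
Proof.
move=> /andP[t0 t1].
rewrite ln_div ?posrE; [|lra|lra].
pose f : R -> R := (@ln R \o (cst 1 + id)) - (@ln R \o (cst 1 - id)) -
  ((fun v => 2 * v ^+ 1) + (fun v => 2 / 3 * v ^+ 3) +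
   (fun v => 2 / 5 * v ^+ 5) + (fun v => 2 / 7 * v ^+ 7)).
pose df (u : R) : R := 2 / (1 - u ^+ 2) -
  (2 + 2 * u ^+ 2 + 2 * u ^+ 4 + 2 * u ^+ 6).
have fdf u : 0 <= u <= t -> is_derive u 1 f (df u).
  move=> /andP[u0 ut].
  have u1 : -1 < u < 1 by lra.
  apply: is_derive_eq (is_deriveB (is_derive_ln_ratio u1)
    (is_deriveD (is_deriveD (is_deriveD (is_derive_monomial 2 u 0)
      (is_derive_monomial (2 / 3) u 2)) (is_derive_monomial (2 / 5) u 4))
      (is_derive_monomial (2 / 7) u 6))) _.
  by rewrite /df; congr (_ - _); field.
have df0 u : 0 <= u <= t -> 0 <= df u.
  move=> /andP[u0 ut].
  have u2 : 0 < 1 - u ^+ 2 by nra.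
  rewrite (_ : df u = 2 * u ^+ 8 / (1 - u ^+ 2)).
    by rewrite divr_ge0 ?mulr_ge0 ?exprn_ge0// ltW.
  by rewrite /df; field; rewrite gt_eqF.
have := is_derive_ge0_le t0 fdf df0.
rewrite /f !fctE /= /GRing.scale /= addr0 subr0 ln1 !expr0n /=.
lra.
Qed.

(* The factor [K] absorbs the tail of the series: it dominates [1 / (1 - t ^ 2)]. *)
Lemma ln_ratio_le (R : realType) (t K : R) :
  0 <= t < 1 -> 1 <= K * (1 - t ^+ 2) ->
  ln ((1 + t) / (1 - t)) <= 2 * t + 2 / 3 * t ^+ 3 + 2 / 5 * K * t ^+ 5.
Proof.
move=> /andP[t0 t1] K1.
rewrite ln_div ?posrE; [|lra|lra].
pose f : R -> R :=
  ((fun v => 2 * v ^+ 1) + (fun v => 2 / 3 * v ^+ 3) +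
   (fun v => 2 / 5 * K * v ^+ 5)) -
  ((@ln R \o (cst 1 + id)) - (@ln R \o (cst 1 - id))).
pose df (u : R) : R := 2 + 2 * u ^+ 2 + 2 * K * u ^+ 4 - 2 / (1 - u ^+ 2).
have fdf u : 0 <= u <= t -> is_derive u 1 f (df u).
  move=> /andP[u0 ut].
  have u1 : -1 < u < 1 by lra.
  apply: is_derive_eq (is_deriveB
    (is_deriveD (is_deriveD (is_derive_monomial 2 u 0)
      (is_derive_monomial (2 / 3) u 2)) (is_derive_monomial (2 / 5 * K) u 4))
    (is_derive_ln_ratio u1)) _.
  by rewrite /df; congr (_ - _); field.
have df0 u : 0 <= u <= t -> 0 <= df u.
  move=> /andP[u0 ut].
  have u2 : 0 < 1 - u ^+ 2 by nra.
  have t2 : 0 < 1 - t ^+ 2 by nra.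
  have tu : 1 - t ^+ 2 <= 1 - u ^+ 2 by nra.
  have K0 : 0 <= K by nra.
  (* Summing the geometric series from its third term on leaves a sign that is decided by [K]; the
     bound on [K] at [t] carries over to every [u <= t]. *)
  rewrite (_ : df u = 2 * u ^+ 4 * (K - (1 - u ^+ 2)^-1)).
    rewrite !mulr_ge0 ?exprn_ge0// subr_ge0 -div1r ler_pdivrMr//.
    by apply: le_trans K1 _; rewrite ler_wpM2l.
  by rewrite /df; field; rewrite gt_eqF.
have := is_derive_ge0_le t0 fdf df0.
rewrite /f !fctE /= /GRing.scale /= addr0 subr0 ln1 !expr0n /=.
lra.
Qed.

(** * Splitting, evaluating and reflecting integrals over intervals *)

Section Rintegral_itv.
Variable R : realType.
Local Notation mu := (@lebesgue_measure R).
Implicit Types (f F : R -> R) (a b c : R).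

Lemma continuous_integrable_cc f a b : continuous f ->
  mu.-integrable `[a, b] (EFin \o f).
Proof.
move=> cf; apply: continuous_compact_integrable; first exact: segment_compact.
exact: continuous_subspaceT.
Qed.

(** The right piece excludes [c], for integrands that are controlled only strictly beyond [c]. *)
Lemma Rintegral_split f a c b : mu.-integrable `[a, b] (EFin \o f) ->
  a <= c -> c <= b ->
  \int[mu]_(t in `[a, b]) f t =
    \int[mu]_(t in `[a, c]) f t + \int[mu]_(t in `]c, b]) f t.
Proof. by move=> fi ac cb; rewrite -(Rintegral_itvB fi) ?bnd_simp// addrC subrK. Qed.

Lemma Rintegral_splitcc f a c b : mu.-integrable `[a, b] (EFin \o f) ->
  a <= c -> c <= b ->
  \int[mu]_(t in `[a, b]) f t =
    \int[mu]_(t in `[a, c]) f t + \int[mu]_(t in `[c, b]) f t.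
Proof.
move=> fi ac cb; rewrite (Rintegral_split fi ac cb) Rintegral_itv_obnd_cbnd//.
by apply: integrableS fi => //; apply: subset_itv; rewrite bnd_simp.
Qed.

Lemma Rintegral_FTC2 f F a b : a <= b -> continuous f ->
  (forall t : R, is_derive t 1 F (f t)) ->
  \int[mu]_(t in `[a, b]) f t = F b - F a.
Proof.
rewrite le_eqVlt => /predU1P[<- _ _|ab cf dF].
  by rewrite set_itv1 Rintegral_set1 subrr.
have cF : continuous F.
  move=> t; apply: differentiable_continuous; apply/derivable1_diffP.
  by have [] := dF t.
rewrite /Rintegral (@continuous_FTC2 _ _ F)//.
- exact: continuous_subspaceT.
- split; first by move=> t _; have [] := dF t.
  + by apply: cvg_at_right_filter; exact: cF.
  + by apply: cvg_at_left_filter; exact: cF.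
- by move=> t _; rewrite derive1E; have [_ ->] := dF t.
Qed.

(** Needed because [u] decreases as [delta] increases. *)
Lemma Rintegral_reflect f a b c : a <= b -> continuous f ->
  \int[mu]_(t in `[a, b]) f (c - t) = \int[mu]_(t in `[(c - b), (c - a)]) f t.
Proof.
move=> ab cf.
have dF (t : R) : is_derive t 1 (cst c - id : R -> R) (-1).
  by apply: is_derive_eq; rewrite sub0r.
have cF : continuous (cst c - id : R -> R).
  move=> t; apply: differentiable_continuous; apply/derivable1_diffP.
  by have [] := dF t.
have D : (cst c - id : R -> R)^`() = cst (-1).
  by apply/funext => t; rewrite derive1E; have [_ ->] := dF t.
rewrite /Rintegral; congr fine.
have := @integration_by_substitution_decreasing R (cst c - id) f a b ab.
rewrite D => -> //.
- by apply: eq_integral => t _; rewrite !fctE opprK mulr1.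
- by move=> u v _ _ uv; rewrite !fctE ltrD2l ltrN2.
- by move=> u _; exact: cvg_cst.
- exact: is_cvg_cst.
- exact: is_cvg_cst.
- split; first by move=> t _; have [] := dF t.
  + by apply: cvg_at_right_filter; exact: cF.
  + by apply: cvg_at_left_filter; exact: cF.
- exact: continuous_subspaceT.
Qed.

End Rintegral_itv.

Lemma Rintegral_dist_le (d : measure_display) (T : measurableType d)
    (R : realType) (mu : {measure set T -> \bar R}) (A : set T)
    (f g : T -> R) (e : R) : measurable A ->
  (mu A < +oo)%E -> mu.-integrable A (EFin \o f) ->
  mu.-integrable A (EFin \o g) ->
  (forall t, A t -> `|f t - g t| <= e) ->
  `|\int[mu]_(t in A) f t - \int[mu]_(t in A) g t| <= e * fine (mu A).
Proof.
move=> mA Afin fi gi fg; rewrite -RintegralB//.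
have fgi : mu.-integrable A (EFin \o (fun t => f t - g t)).
  by have := integrableB mA fi gi; apply: eq_integrable.
apply: le_trans (le_normr_Rintegral mA fgi) _.
rewrite -Rintegral_cst//; apply: le_Rintegral => //.
- exact: integrable_norm fgi.
- by apply: measurable_bounded_integrable => //; exact: bounded_cst.
Qed.

(* With [L = ln x], the limiting ratio when the separator stands at [n * x ^ (- u)]. *)
Definition limit_ratio (R : realType) (L u : R) : R :=
  2 * Num.max (expR (- (L * u))) (1 - expR (- (L * u))).

(** * The integral of the limiting ratio *)

Lemma is_derive_expRN (R : realType) (L u : R) :
  is_derive u 1 (fun u => expR (- (L * u))) (- L * expR (- (L * u))).
Proof.
have dl : is_derive u 1 (fun u => - (L * u)) (- L).
  have : is_derive u 1 (- (L *: id) : R -> R) (- (L *: 1)) by exact: is_deriveN.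
  by rewrite /GRing.scale /= mulr1.
have := @is_derive1_comp R expR (fun u => - (L * u)) u _ _ (is_derive_expR _) dl.
by rewrite mulrC.
Qed.

Lemma continuous_expRN (R : realType) (L : R) :
  continuous (fun u : R => expR (- (L * u))).
Proof.
move=> u; apply: differentiable_continuous; apply/derivable1_diffP.
by have [] := is_derive_expRN L u.
Qed.

Lemma continuous_limit_ratio (R : realType) (L : R) :
  continuous (limit_ratio L).
Proof.
move=> u; apply: (@continuousM _ _ (cst 2) (fun v => Num.max _ _)); first exact: cvg_cst.
apply: continuous_max; first exact: continuous_expRN.
by apply: continuousB; [exact: cvg_cst|exact: continuous_expRN].
Qed.

(* The two branches of the maximum cross where [exp (- L u) = 1 / 2]. *)
Lemma Rintegral_limit_ratio (R : realType) (L : R) : ln 2 <= L ->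
  \int[lebesgue_measure]_(u in `[0, 1]) limit_ratio L u =
    2 + 2 * (expR (- L) - ln 2) / L.
Proof.
move=> L2; have l2 : 0 < ln (2 : R) by apply: ln_gt0; lra.
have L0 : 0 < L by lra.
(* The crossing point of the two branches; [ln 2 <= L] keeps it at most 1. *)
pose a := ln 2 / L.
have a0 : 0 <= a by rewrite divr_ge0 ?ltW.
have a1 : a <= 1 by rewrite ler_pdivrMr ?mul1r.
have La : L * a = ln 2 by rewrite mulrC divfK ?gt_eqF.
have Ea : expR (- (L * a)) = 2^-1 by rewrite La expRN lnK ?posrE//; lra.
have pos2 : (2 : R) \is Num.pos by rewrite posrE; lra.
rewrite (@Rintegral_splitcc R _ 0 a 1)//; last first.
  exact: continuous_integrable_cc (continuous_limit_ratio (L := L)).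
rewrite (@eq_Rintegral _ _ _ lebesgue_measure _
  (fun u => 2 * expR (- (L * u)))); last first.
  move=> u; rewrite inE /= in_itv /= => /andP[u0 ua].
  rewrite /limit_ratio; congr (_ * _); apply/max_idPl.
  have : expR (- (L * a)) <= expR (- (L * u)) by rewrite ler_expR lerN2 ler_pM2l.
  by rewrite Ea; lra.
rewrite (@eq_Rintegral _ _ _ lebesgue_measure `[a, 1]
  (fun u => 2 * (1 - expR (- (L * u))))); last first.
  move=> u; rewrite inE /= in_itv /= => /andP[ua u1].
  rewrite /limit_ratio; congr (_ * _); apply/max_idPr.
  have : expR (- (L * u)) <= expR (- (L * a)) by rewrite ler_expR lerN2 ler_pM2l.
  by rewrite Ea; lra.
pose E u := expR (- (L * u)).
have dcE (c u : R) : is_derive u 1 (c *: E) (c *: (- L * E u)).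
  exact: (@is_deriveZ R R R E c u 1 _ (is_derive_expRN L u)).
pose f1 u := 2 * E u; pose f2 u := 2 * (1 - E u).
pose F1 : R -> R := - (2 / L) *: E.
pose F2 : R -> R := (fun v => 2 * v ^+ 1) + (2 / L) *: E.
have cE : continuous E by exact: continuous_expRN.
have cf1 : continuous f1.
  by move=> u; apply: (@continuousM _ _ (cst 2) E); [exact: cvg_cst|exact: cE].
have cf2 : continuous f2.
  move=> u; apply: (@continuousM _ _ (cst 2) (cst 1 - E)); first exact: cvg_cst.
  by apply: continuousB; [exact: cvg_cst|exact: cE].
have dF1 (u : R) : is_derive u 1 F1 (f1 u).
  apply: is_derive_eq (dcE _ u) _.
  by rewrite /GRing.scale /= /f1; field; rewrite gt_eqF.
have dF2 (u : R) : is_derive u 1 F2 (f2 u).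
  apply: is_derive_eq (is_deriveD (is_derive_monomial 2 u 0) (dcE _ u)) _.
  by rewrite /GRing.scale /= /f2; field; rewrite gt_eqF.
(* The pieces contribute [1 / L] and [2 + 2 expR (- L) / L - 2 a - 1 / L]. *)
rewrite (Rintegral_FTC2 a0 cf1 dF1) (Rintegral_FTC2 a1 cf2 dF2).
rewrite /F1 /F2 !fctE /GRing.scale /= /E Ea mulr0 oppr0 expR0 !mulr1 /a.
by field; rewrite gt_eqF.
Qed.

(** * Averaging the ratio over [delta] *)

Lemma fine_lebesgue_measure_itv (R : realType) (b0 b1 : bool) (a b : R) :
  a <= b ->
  fine (lebesgue_measure [set` Interval (BSide b0 a) (BSide b1 b)]) = b - a.
Proof.
rewrite le_eqVlt lebesgue_measure_itv /= lte_fin => /predU1P[->|->//].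
by rewrite ltxx subrr.
Qed.

(** The last hypothesis says that [n] is [x] to the power [k + delta + u]. As [0 <= u < 1], the
    index [k] is that of the last power at most [n], and this power divided by [n] is
    [expR (- (ln x * u))]. *)
Lemma ratio_geom_limit (R : realType) (x delta u : R) (k n : nat) :
  2 < x -> 0 <= delta -> 0 <= u < 1 -> (0 < n)%N ->
  ln n%:R = ln x * (k%:R + delta + u) ->
  `|Defs.ratio R (geom_alg x delta) (nseq n 1%N) - limit_ratio (ln x) u|
    <= 4 / n%:R.
Proof.
move=> x2 d0 /andP[u0 u1] n0 lnn.
have L0 : 0 < ln x by apply: ln_gt0; lra.
have xE r : x `^ r = expR (r * ln x) by rewrite /powR gt_eqF//; lra.
have nE : n%:R = expR (ln x * (k%:R + delta + u)) by rewrite -lnn lnK// posrE ltr0n.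
have kn : x `^ (k%:R + delta) <= n%:R < x `^ (k.+1%:R + delta).
  rewrite nE !xE ler_expR ltr_expR mulrC ler_pM2l// [ltRHS]mulrC ltr_pM2l//.
  by rewrite -natr1; apply/andP; split; lra.
have sE : x `^ (k%:R + delta) / n%:R = expR (- (ln x * u)).
  by rewrite nE xE -expRB; congr expR; ring.
by have := ratio_geom_near x2 d0 kn; rewrite sE.
Qed.

Lemma expected_ratio_Rintegral (R : realType) (x : R) (n : nat) :
  expected_ratio x n = \int[lebesgue_measure]_(delta in `[0, 1])
    Defs.ratio R (geom_alg x delta) (nseq n 1%N).
Proof.
rewrite /expected_ratio unlock integral_uniform.
- by rewrite subr0 invr1 mul1e.
- by apply/measurable_EFinP; exact: measurable_ratio_geom.
- by move=> delta; rewrite lee_fin ratio_ge0.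
Qed.

Lemma ratio_le_sumn (R : realType) (A : preemptive_alg) (r : seq nat) :
  Defs.ratio R A r <= (sumn r)%:R.
Proof.
have bs : (bottleneck (final_separator A r) r <= sumn r)%N.
  case: (final_separator A r) => //= k.
  by rewrite geq_max -{2 4}(cat_take_drop k r) !sumn_cat leq_addr leq_addl.
rewrite /Defs.ratio -[leRHS]mulr1 ler_pM ?invr_ge0 ?ler0n ?ler_nat//.
(* A zero optimum is harmless, since the inverse of 0 is 0 by convention. *)
case: (opt_bottleneck r) => [|m]; first by rewrite invr0 ler01.
by rewrite invf_le1 ?ler1n ?ltr0n.
Qed.

Lemma integrable_ratio_geom (R : realType) (x : R) (n : nat) :
  (@lebesgue_measure R).-integrable `[0, 1]
    (EFin \o (fun delta => Defs.ratio R (geom_alg x delta) (nseq n 1%N))).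
Proof.
apply: measurable_bounded_integrable => //.
- by rewrite /= lebesgue_measure_itv /= lte_fin ltr01 -EFinB ltry.
- exact: measurable_funTS (measurable_ratio_geom _ _).
- exists (sumn (nseq n 1%N))%:R; split; first by rewrite num_real.
  move=> M nM delta _ /=; rewrite ger0_norm ?ratio_ge0//.
  exact: le_trans (ratio_le_sumn _ _ _) (ltW nM).
Qed.

(** With [m + theta] the logarithm of [n] in base [x], the interval of [delta] is cut at [theta]. Up
    to [theta] the last power has index [m] and [u = theta - delta]; beyond it the index is [m - 1]
    and [u = theta + 1 - delta]. Reflection matches these pieces with the integral of
    [limit_ratio]. *)
Lemma expected_ratio_near (R : realType) (x : R) (n : nat) :
  2 < x -> x <= n%:R ->
  `|expected_ratio x n - (2 + 2 * (x^-1 - ln 2) / ln x)| <= 4 / n%:R.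
Proof.
move=> x2 xn.
have n0 : (0 < n)%N by rewrite -(ltr_nat R); lra.
have l2 : 0 < ln (2 : R) by apply: ln_gt0; lra.
have L2 : ln 2 <= ln x by rewrite ler_ln ?posrE; lra.
have L0 : 0 < ln x by lra.
have y1 : 1 <= ln n%:R / ln x.
  by rewrite ler_pdivlMr// mul1r ler_ln ?posrE//; lra.
have [m mE] : exists m, Num.truncn (ln n%:R / ln x) = m by eexists.
have := @truncn_itv R (ln n%:R / ln x); rewrite mE => /(_ ltac:(lra)).
move: mE => _ /andP[my ym].
have [theta thE] : exists theta, ln n%:R / ln x = m%:R + theta.
  by exists (ln n%:R / ln x - m%:R); ring.
rewrite thE in y1 my ym.
have t0 : 0 <= theta by lra.
have t1 : theta < 1 by rewrite -natr1 in ym; lra.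
(* From [x <= n]; it makes the index [m.-1] meaningful when [delta] exceeds [theta]. *)
have m0 : (0 < m)%N by rewrite lt0n; apply/eqP => m0; rewrite m0 in y1; lra.
have lnn : ln n%:R = ln x * (m%:R + theta) by rewrite -thE mulrC divfK ?gt_eqF.
rewrite expected_ratio_Rintegral.
have ri := integrable_ratio_geom x n.
have cphi := @continuous_limit_ratio R (ln x).
rewrite (Rintegral_split ri t0 (ltW t1)).
have -> : 2 + 2 * (x^-1 - ln 2) / ln x =
    \int[lebesgue_measure]_(u in `[0, 1]) limit_ratio (ln x) u.
  by rewrite Rintegral_limit_ratio// expRN lnK// posrE; lra.
have phii a b := continuous_integrable_cc a b cphi.
rewrite (Rintegral_splitcc (phii 0 1) t0 (ltW t1)).
have crefl c : continuous (fun t : R => limit_ratio (ln x) (c - t)).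
  move=> t; apply: (@continuous_comp _ _ _ (fun t : R => c - t)).
    by apply: continuousB; [exact: cvg_cst|exact: cvg_id].
  exact: cphi.
have := @Rintegral_reflect R _ 0 theta theta t0 cphi; rewrite subrr subr0 => <-.
have := @Rintegral_reflect R _ theta 1 (theta + 1) (ltW t1) cphi.
rewrite addrK [theta + 1 - theta]addrAC subrr add0r => <-.
rewrite -(@Rintegral_itv_obnd_cbnd R theta (BRight 1)); last first.
  apply: integrableS (continuous_integrable_cc theta 1 (crefl (theta + 1))) => //.
  by apply: subset_itv; rewrite bnd_simp.
rewrite opprD addrACA; apply: le_trans (ler_normD _ _) _.
(* The pointwise error [4 / n] is shared between the pieces in proportion to their lengths. *)
rewrite (_ : 4 / n%:R = 4 / n%:R * theta + 4 / n%:R * (1 - theta)); last by ring.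
apply: lerD.
- apply: le_trans (Rintegral_dist_le (e := 4 / n%:R) _ _ _ _ _) _ => //.
  + rewrite /= lebesgue_measure_itv /= lte_fin.
    by case: ifP => _; rewrite ?ltry -?EFinB ?ltry.
  + apply: integrableS ri => //.
    by apply: subset_itv; rewrite bnd_simp// ltW.
  + exact: continuous_integrable_cc.
  + move=> t /=; rewrite in_itv /= => /andP[h1 h2].
    by apply: (ratio_geom_limit (k := m)) => //; [lra|rewrite lnn; ring].
  + by rewrite fine_lebesgue_measure_itv// subr0.
- apply: le_trans (Rintegral_dist_le (e := 4 / n%:R) _ _ _ _ _) _ => //.
  + rewrite /= lebesgue_measure_itv /= lte_fin.
    by case: ifP => _; rewrite ?ltry -?EFinB ?ltry.
  + apply: integrableS ri => //.
    by apply: subset_itv; rewrite bnd_simp// ltW.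
  + apply: integrableS (continuous_integrable_cc theta 1 (crefl (theta + 1))) => //.
    by apply: subset_itv; rewrite bnd_simp.
  + move=> t /=; rewrite in_itv /= => /andP[h1 h2].
    (* Here [u = theta + 1 - t < 1] requires [theta < t], hence the half-open interval. *)
    apply: (ratio_geom_limit (k := m.-1)) => //; [lra|lra|].
    by rewrite lnn -[m in LHS](prednK m0) -natr1; ring.
  + by rewrite fine_lebesgue_measure_itv// ltW.
Qed.

(** * The asymptotic estimate and the numerical constants *)

Lemma expected_ratio_eqaddO (R : realType) (x : R) : 2 < x ->
  expected_ratio x =
    cst (2 + 2 * (x^-1 - ln 2) / ln x) +O_\oo (fun n => n%:R^-1 : R).
Proof.
move=> x2; apply/eqaddOP; near=> k; near=> n.
rewrite !fctE; apply: le_trans (expected_ratio_near x2 _) _.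
  near: n; exact: nbhs_infty_ger.
by rewrite ger0_norm ?invr_ge0 ?ler0n// ler_wpM2r ?invr_ge0 ?ler0n//.
Unshelve. all: end_near. Qed.

Theorem theorem3 (R : realType) :
  exists x c : R,
    [/\ 2 < x,
        3052 / 1000 <= x < 3053 / 1000,
        1344 / 1000 <= c < 1345 / 1000 &
        expected_ratio x = cst c +O_\oo (fun n => n%:R^-1 : R)].
Proof.
(* A rational close to the minimiser of the limit, which solves [x * ln 2 = 1 + ln x]. *)
pose x : R := 3052 / 1000.
have x2 : 2 < x by rewrite /x; lra.
exists x, (2 + 2 * (x^-1 - ln 2) / ln x); split => //.
- by rewrite /x; apply/andP; split; lra.
(* Factoring [x] as [2 * 1.526] keeps the series arguments [t = (y - 1) / (y + 1)] small. Precision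
   matters: the limit is only about [0.0001] below [1.345]. *)
- have e2 : (2 : R) = (1 + 1 / 3) / (1 - 1 / 3) by field.
  have ey : (1526 / 1000 : R) = (1 + 263 / 1263) / (1 - 263 / 1263) by field.
  have lx : ln x = ln 2 + ln (1526 / 1000).
    by rewrite -lnM ?posrE; [congr ln; rewrite /x; field|lra|lra].
  have vx : x^-1 = 1000 / 3052 by rewrite /x; field.
  (* [9 / 8] is exactly [1 / (1 - t ^+ 2)] at [t = 1 / 3]; below, [21 / 20] rounds up its value at
     [263 / 1263]. *)
  have := @ln_ratio_ge R (1 / 3); have := @ln_ratio_le R (1 / 3) (9 / 8).
  rewrite -e2 => /(_ ltac:(lra) ltac:(lra)) h1 /(_ ltac:(lra)) h2.
  have := @ln_ratio_ge R (263 / 1263); have := @ln_ratio_le R (263 / 1263) (21 / 20).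
  rewrite -ey => /(_ ltac:(lra) ltac:(lra)) h3 /(_ ltac:(lra)) h4.
  rewrite vx lx; move: h1 h2 h3 h4.
  (* Once the positive denominator [l2 + ly] is cleared, both bounds are linear in the two
     logarithms. *)
  move: (ln 2) (ln (1526 / 1000)) => l2 ly h1 h2 h3 h4.
  have L0 : 0 < l2 + ly by lra.
  apply/andP; split.
  + rewrite -lerBlDl ler_pdivlMr//; lra.
  + rewrite -ltrBrDl ltr_pdivrMr//; lra.
- exact: expected_ratio_eqaddO.
Qed.
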